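(* Let $r\geq 2$, $0<c\leq 1/2$, let $H$ be a graph with vertex set $\{v_1,\ldots,v_r\}$, and let $G$ be a graph of order $n$. If $G$ contains more than $cn^{r}$ induced copies of $H$, then $G$ contains an induced subgraph of type $H(s,\ldots,s,t)$, where $s=\lfloor c^{r^{2}}\ln n\rfloor$ and $t$ is an integer with $t>n^{1-c^{r-1}}$.
   Context: For a graph $H$ with vertices $v_1,\ldots,v_r$ and positive integers $x_1,\ldots,x_r$, $H(x_1,\ldots,x_r)$ denotes the graph obtained by replacing each vertex $v_i$ with a set $V_{v_i}$ of $x_i$ vertices (the sets pairwise disjoint, each independent) and each edge $v_iv_j\in E(H)$ with a complete bipartite graph between $V_{v_i}$ and $V_{v_j}$. A graph $X$ is of type $H(x_1,\ldots,x_r)$ if $X$ is obtained from $H(x_1,\ldots,x_r)$ by adding some edges within the sets $V_{v_i}$ (so between different classes $V_{v_i},V_{v_j}$ there are all edges if $v_iv_j\in E(H)$ and no edges otherwise). In $H(s,\ldots,s,t)$ the classes of $v_1,\ldots,v_{r-1}$ have size $s$ and the class of $v_r$ has size $t$. $\ln$ is the natural logarithm. *)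

(* Defs.v *)
From HB Require Import structures.
From mathcomp Require Import all_boot all_order all_algebra.
From mathcomp Require Import boolp reals exp.
Set Implicit Arguments. Unset Strict Implicit. Unset Printing Implicit Defensive.
Import Order.TTheory GRing.Theory Num.Theory.

Definition is_graph (V : finType) (e : rel V) : Prop :=
  irreflexive e /\ symmetric e.

Definition induced_copy (r : nat) (h : rel 'I_r) (V : finType) (g : rel V)
  (S : {set V}) : bool :=
  [exists f : {ffun 'I_r -> V},
     [&& injectiveb f, [set f i | i in 'I_r] == S &
         [forall i, forall j, g (f i) (f j) == h i j]]].

Definition num_induced_copies (r : nat) (h : rel 'I_r) (V : finType) (g : rel V)
  : nat := #|[set S : {set V} | induced_copy h g S]|.

(* G contains an induced subgraph of type H(s,...,s,t): pairwise disjoint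
   classes P i, of size s for i < r-1 and of size t for i = r-1 (the vertex v_r),
   with all edges between P i and P j (i <> j) iff ij is an edge of H, no edges
   otherwise; edges inside the classes are arbitrary. *)
Definition has_induced_type_sst (r : nat) (h : rel 'I_r) (V : finType) (g : rel V)
  (s t : nat) : Prop :=
  exists P : 'I_r -> {set V},
    [/\ (forall i j, i != j -> [disjoint P i & P j]),
        (forall i : 'I_r, (val i < r.-1)%N -> #|P i| = s),
        (forall i : 'I_r, val i = r.-1 -> #|P i| = t) &
        (forall i j x y, i != j -> x \in P i -> y \in P j -> g x y = h i j)].

(* Main.v *)
(* Work with the set M_r of ordered embeddings of H, and let M_(k-1) be the set
   of (k-1)-tuples having at least 2n/K extensions in M_k.  Counting shows that
   M_1 is still large.  Climb back: from a family of s K tuples of M_(k-1),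
   each with 2n/K extensions, the pigeonhole principle on the 2^(s K) possible
   neighbourhoods yields s of these tuples and a set T of at least
   n / (K 2^(s K)) common extensions.  Matching the s tuples with distinct
   elements of T gives s tuples of M_k; because the relations are pairwise, the
   s tuples span a complete blow-up, not merely s copies.  With
   K ~ 8 / (3 c^(r-1)) and families of size s K^(r-k) at level k, the size
   s <= c^(r^2) ln n keeps all the exponential losses below the required power
   of n. *)
Require Import Defs.
From HB Require Import structures.
From mathcomp Require Import all_boot all_order all_algebra.
From mathcomp Require Import zify ring lra.
From mathcomp Require Import boolp reals sequences exp.
Import Order.TTheory GRing.Theory Num.Theory.
Local Open Scope ring_scope.

(** * Double counting and pigeonhole in a dense bipartite relation *)

Section Pigeonhole.
Set Implicit Arguments. Unset Strict Implicit.
Local Open Scope nat_scope.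

Lemma pigeonhole_fiber (X Y : finType) (f : X -> Y)
    (B : {set X}) (C : {set Y}) :
  0 < #|C| -> (forall x, x \in B -> f x \in C) ->
  exists2 y, y \in C & #|B| <= #|C| * #|[set x in B | f x == y]|.
Proof.
case/card_gt0P=> y0 y0C fBC.
pose F y := #|[set x in B | f x == y]|.
case: (arg_maxnP F y0C) => y yC ymax.
exists y => //.
rewrite -sum1_card (partition_big f (mem C)) //= -sum_nat_const.
by apply: leq_sum => z zC; rewrite sum1dep_card; exact: ymax.
Qed.

Lemma exists_subset_card (X : finType) (S : {set X}) (s : nat) :
  s <= #|S| -> exists2 A : {set X}, A \subset S & #|A| = s.
Proof.
rewrite -bin_gt0 -cards_draws => /card_gt0P[A].
by rewrite inE => /andP[AS /eqP cA]; exists A.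
Qed.

(** There are at least [2 * s * #|V|] edges, and vertices with fewer than [s] neighbours in [S]
    carry at most [s * #|V|] of them, so at least [#|V| / K] vertices have [s] or more. Grouping
    these by neighbourhood, one of [2 ^ (s * K)] subsets of [S], gives [T]. *)
Lemma dense_bipartite (X V : finType) (E : X -> V -> bool) (S : {set X})
    (K s : nat) :
  0 < s -> 0 < K -> #|S| = s * K ->
  (forall x, x \in S -> 2 * #|V| <= K * #|[set v | E x v]|) ->
  exists (A : {set X}) (T : {set V}),
    [/\ A \subset S, #|A| = s,
        forall x v, x \in A -> v \in T -> E x v &
        #|V| <= K * 2 ^ (s * K) * #|T|].
Proof.
move=> s0 K0 cS degE.
pose N v := [set x in S | E x v].
pose B := [set v | s <= #|N v|].
have edges : \sum_(x in S) #|[set v | E x v]| = \sum_v #|N v|.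
  under eq_bigr do rewrite -sum1dep_card.
  rewrite (exchange_big_dep xpredT) //=; apply: eq_bigr => v _.
  by rewrite sum1dep_card.
have low : s * K * (2 * #|V|) <= K * \sum_v #|N v|.
  by rewrite -edges big_distrr /= -cS -sum_nat_const; exact: leq_sum.
have up : \sum_v #|N v| <= #|B| * (s * K) + #|V| * s.
  rewrite (bigID (mem B)) /=; apply: leq_add.
    rewrite -sum_nat_const; apply: leq_sum => v _; rewrite -cS.
    by apply/subset_leq_card/subsetP => x; rewrite inE => /andP[].
  rewrite -sum_nat_const big_mkcond /=; apply: leq_sum => v _.
  by rewrite /= inE -ltnNge; case: ifP => // /ltnW.
have VB : #|V| <= K * #|B|.
  have le2 : K * s * (2 * #|V|) <= K * s * (#|B| * K + #|V|).
    have -> : K * s * (#|B| * K + #|V|) = K * (#|B| * (s * K) + #|V| * s).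
      by nia.
    by rewrite (mulnC K s); apply: leq_trans low _; rewrite leq_mul2l up orbT.
  move: le2; rewrite leq_pmul2l ?muln_gt0 ?K0 ?s0 //; lia.
have [||N0 _] := @pigeonhole_fiber _ _ N B (powerset S).
- by rewrite card_powerset expn_gt0.
- by move=> v _; rewrite powersetE; apply/subsetP => x; rewrite inE => /andP[].
rewrite card_powerset cS; set T := [set _ in _ | _] => leBT.
(* An element of [T] shows that [N0] has at least [s] elements. If [T] is empty, the bounds force
   [V] to be empty, and any [s] elements of [S] will do. *)
have [T0|[v0]] := set_0Vmem T.
  have B0 : #|B| = 0.
    by apply/eqP; rewrite -leqn0 (leq_trans leBT) // T0 cards0 muln0.
  have V0 : #|V| = 0.
    by apply/eqP; rewrite -leqn0 (leq_trans VB) // B0 muln0.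
  have : s <= #|S| by rewrite cS leq_pmulr.
  case/exists_subset_card => A AS cA.
  by exists A, set0; split=> // [x v _|]; rewrite ?inE // V0.
rewrite !inE => /andP[leN /eqP NN0].
have : s <= #|N0| by rewrite -NN0.
case/exists_subset_card => A AN cA; exists A, T; split=> //.
- apply: subset_trans AN _; rewrite -NN0.
  by apply/subsetP => x; rewrite inE => /andP[].
- move=> x v /(subsetP AN) xN; rewrite !inE => /andP[_ /eqP NvN].
  by move: xN; rewrite -NvN inE => /andP[].
- by apply: leq_trans VB _; rewrite -mulnA leq_mul2l leBT orbT.
Qed.

End Pigeonhole.

(** * Blow-ups as families of tuples *)

Section Grids.
Set Implicit Arguments. Unset Strict Implicit.
Local Open Scope nat_scope.
Variables (V : finType) (v0 : V) (R : nat -> nat -> rel V).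

Definition consistent k (S : {set k.-tuple V}) :=
  forall x y i j, x \in S -> y \in S -> i != j -> i < k -> j < k ->
  R i j (nth v0 x i) (nth v0 y j).

Definition transversal k (S : {set k.-tuple V}) :=
  forall x y i, x \in S -> y \in S -> i < k -> nth v0 x i = nth v0 y i -> x = y.

(** Class [i] of the blow-up is the set of [i]-th coordinates. [consistent] also compares different
    tuples, and [transversal] gives every class the size of [S]. *)
Definition grid k S := @consistent k S /\ @transversal k S.

Definition ext k (M : {set k.+1.-tuple V}) (x : k.-tuple V) :=
  [set v | [tuple of rcons x v] \in M].

Lemma card_ext k (M : {set k.+1.-tuple V}) : #|M| = \sum_x #|ext M x|.
Proof.
pose f (p : k.-tuple V * V) : k.+1.-tuple V := [tuple of rcons p.1 p.2].
have f_inj : injective f.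
  move=> [x v] [y w] /(congr1 val)/= /rcons_inj [xy ->].
  by congr pair; exact: val_inj.
have {1}-> : M = f @: [set p | f p \in M].
  apply/setP => t; apply/idP/imsetP => [tM|[p]]; last by rewrite inE => pM ->.
  have [x [v tE]] : exists x : k.-tuple V, exists v, t = [tuple of rcons x v].
    case: t tM => t; case/lastP: t => // t v st _.
    have st' : size t == k by move: st; rewrite size_rcons.
    by exists (Tuple st'), v; exact: val_inj.
  by exists (x, v); rewrite ?inE /f /= -?tE.
rewrite card_imset // -sum1dep_card.
rewrite (eq_bigr (fun x => \sum_(v | f (x, v) \in M) 1)) => [|x _].
  by rewrite pair_big_dep /=; apply: eq_bigl => -[x v].
by rewrite sum1dep_card.
Qed.

Definition rich K k (M : {set k.+1.-tuple V}) :=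
  [set x | 2 * #|V| <= K * #|ext M x|].

(** A rich tuple has at most [#|V|] extensions; for each of the others, at most [#|V| ^ k] in
    number, [K] times the number of extensions is below [2 * #|V|]. *)
Lemma card_rich K k (M : {set k.+1.-tuple V}) :
  K * #|M| <= K * #|V| * #|rich K M| + 2 * #|V| ^ k.+1.
Proof.
rewrite card_ext big_distrr (bigID (mem (rich K M))) /=; apply: leq_add.
  rewrite mulnC -sum_nat_const; apply: leq_sum => x _.
  by rewrite leq_mul2l max_card orbT.
apply: (@leq_trans (\sum_(x : k.-tuple V) 2 * #|V|)).
  rewrite big_mkcond /=; apply: leq_sum => x _.
  by rewrite /= inE -ltnNge; case: ifP => // /ltnW.
by rewrite sum_nat_const card_tuple expnS mulnC mulnA.
Qed.

Definition compatible k (M : {set k.-tuple V}) :=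
  forall x i j, x \in M -> i != j -> i < k -> j < k ->
  R i j (nth v0 x i) (nth v0 x j).

(* The coefficient 4k+1 absorbs the loss of 2 n^(k+1) in [card_rich] at each of
   the k descents and leaves 2 K |M_1| >= n at the end. *)
Definition abundant K k s (M : {set k.+1.-tuple V}) :=
  [/\ compatible M, 0 < s, (4 * k + 1) * #|V| ^ k.+1 <= 2 * K * #|M|
    & K * (s * K ^ k) * 2 ^ (s * K ^ k).+1 <= #|V|].

(** The length drops by one while [s] is multiplied by [K], so [s * K ^ k] in the size condition is
    invariant. As [V] is nonempty, a rich tuple has an extension and inherits its compatibility. *)
Lemma abundant_rich K k s (M : {set k.+2.-tuple V}) :
  0 < K -> abundant K s M -> abundant K (s * K) (rich K M).
Proof.
move=> K0 [cM s0 dM nbig]; have V0 : 0 < #|V| by apply/card_gt0P; exists v0.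
split.
- move=> x i j; rewrite inE => xrich ij ik jk.
  have /card_gt0P[v] : 0 < #|ext M x| by case: #|_| xrich => // /[!muln0]; lia.
  rewrite inE => /cM/(_ ij (ltnW ik) (ltnW jk)).
  by rewrite /= !nth_rcons size_tuple ik jk.
- by rewrite muln_gt0 s0.
- have := card_rich K M; move: dM.
  rewrite (expnS _ k.+1); move: (#|V| ^ k.+1) => N dM le.
  have : #|V| * ((4 * k + 1) * N) <= #|V| * (2 * K * #|rich K M|) by nia.
  by rewrite leq_pmul2l.
- by rewrite -(mulnA s K) -expnS.
Qed.

(** This is the shape [H(s,...,s,t)]: the grid [S] yields the small classes, and [T], kept whole, is
    the large one. *)
Definition has_fan K k s (M : {set k.+1.-tuple V}) :=
  exists (S : {set k.-tuple V}) (T : {set V}),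
    [/\ grid S, #|S| = s,
        forall x v, x \in S -> v \in T -> [tuple of rcons x v] \in M &
        #|V| <= K * 2 ^ (s * K) * #|T|].

Definition has_grid k s (M : {set k.-tuple V}) :=
  exists2 S : {set k.-tuple V}, S \subset M & grid S /\ #|S| = s.

Lemma grid_subset k (S A : {set k.-tuple V}) : A \subset S -> grid S -> grid A.
Proof.
move=> /subsetP AS [cS tS]; split=> [x y i j xA yA|x y i xA yA].
- by apply: cS; exact: AS.
- by apply: tS; exact: AS.
Qed.

Lemma fan_of_rich_grid K k s (M : {set k.+1.-tuple V}) :
  0 < K -> 0 < s -> has_grid (s * K) (rich K M) -> has_fan K s M.
Proof.
move=> K0 s0 [S /subsetP SM [gS cS]].
have [|A [T [AS cA AT VT]]] :=
  @dense_bipartite _ _ (fun x v => v \in ext M x) S K s s0 K0 cS.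
  move=> x /SM; rewrite inE => /leq_trans; apply.
  rewrite leq_mul2l; apply/orP; right.
  by apply/subset_leq_card/subsetP => v; rewrite inE.
exists A, T; split=> // [|x v xA vT]; first exact: grid_subset gS.
by have := AT x v xA vT; rewrite inE.
Qed.

Lemma grid_of_fan K k s (M : {set k.+1.-tuple V}) :
  0 < K -> (forall i j u v, R i j u v -> R j i v u) ->
  compatible M -> K * 2 ^ (s * K) * s <= #|V| -> has_fan K s M -> has_grid s M.
Proof.
move=> K0 R_sym cM nbig [S [T [[cS tS] cardS ST VT]]].
have sT : s <= #|T|.
  by have := leq_trans nbig VT; rewrite leq_pmul2l // muln_gt0 K0 expn_gt0.
case/exists_subset_card: sT => A /subsetP AT cA.
(* Matching the enumerations of [S] and [A] sends [S] injectively into [T]; the default [v0] is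
   never reached on [S]. *)
pose f (x : k.-tuple V) := nth v0 (enum A) (index x (enum S)).
have idx x : x \in S -> index x (enum S) < #|A|.
  by move=> xS; rewrite cA -cardS cardE index_mem mem_enum.
have fT x : x \in S -> f x \in T.
  by move=> xS; apply: AT; rewrite -mem_enum mem_nth // -cardE idx.
have f_inj x y : x \in S -> y \in S -> f x = f y -> x = y.
  move=> xS yS /eqP; rewrite nth_uniq -?cardE ?idx ?enum_uniq // => /eqP e.
  rewrite -(nth_index x (_ : x \in enum S)) ?mem_enum //.
  by rewrite e nth_index ?mem_enum.
pose g (x : k.-tuple V) := [tuple of rcons x (f x)].
exists (g @: S).
  by apply/subsetP => _ /imsetP[x xS ->]; exact/ST/fT.
split; last first.
  rewrite card_in_imset // => x y xS yS.
  by move=> /(congr1 val)/= /rcons_inj[xy _]; exact: val_inj.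
split=> [_ _ i j /imsetP[x xS ->] /imsetP[y yS ->] ij
        |_ _ i /imsetP[x xS ->] /imsetP[y yS ->]].
- wlog lt_ij : i j x y xS yS ij / i < j.
    move=> wl ik jk; case: (ltngtP i j) => [ltij|ltji|eij]; first exact: wl.
      by apply: R_sym; apply: wl; rewrite // eq_sym.
    by rewrite eij eqxx in ij.
  move=> ik; rewrite ltnS leq_eqVlt => /predU1P[jE|jk].
    (* The mixed tuple, [x] followed by the partner of [y], lies in [M] because [T] consists of
       common extensions. *)
    have := cM _ i j (ST x (f y) xS (fT y yS)) ij ik.
    have ik' : i < k by rewrite -jE.
    by rewrite /= !nth_rcons !size_tuple jE ltnn eqxx ik'; apply; rewrite ltnS.
  rewrite /= !nth_rcons !size_tuple jk (ltn_trans lt_ij jk).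
  by apply: cS => //; exact: ltn_trans jk.
- rewrite ltnS leq_eqVlt => /predU1P[->|ik]; rewrite /= !nth_rcons !size_tuple.
    by rewrite ltnn eqxx => /(f_inj _ _ xS yS) ->.
  by rewrite ik => /(tS _ _ _ xS yS ik) ->.
Qed.

Lemma abundant_grid K k s (M : {set k.+1.-tuple V}) :
  0 < K -> (forall i j u v, R i j u v -> R j i v u) ->
  abundant K s M -> has_grid s M.
Proof.
(* The induction generalises [s], which becomes [s * K] one level down. For 1-tuples consistency is
   vacuous and transversality automatic, so any [s] elements of [M] form a grid. *)
move=> K0 Rs; elim: k s M => [|k IH] s M abM; have [cM s0 dM nbig] := abM.
  have : s <= #|M|.
    move: dM nbig; rewrite !expn0 expn1 !muln1 muln0 add0n mul1n => dM nbig.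
    have : 2 * K * s <= 2 * K * #|M|.
      apply: leq_trans dM; apply: leq_trans nbig.
      by rewrite -mulnA mulnC leq_mul2l expnS leq_pmulr ?orbT ?expn_gt0.
    by rewrite leq_pmul2l // muln_gt0.
  case/exists_subset_card => S SM cS; exists S => //; split=> //.
  split=> [x y [|i] [|j] //|x y [|i] // xS yS _].
  case/tupleP: x xS => a x xS; case/tupleP: y yS => b y yS /= ->.
  by rewrite (tuple0 x) (tuple0 y).
apply: (@grid_of_fan K) => //.
  apply: leq_trans nbig.
  have sK : s * K <= s * K ^ k.+1.
    by rewrite leq_mul2l expnS leq_pmulr ?orbT // expn_gt0 K0.
  rewrite mulnAC; apply: leq_mul.
    by rewrite leq_mul2l (leq_trans _ sK) ?orbT // leq_pmulr.
  by rewrite leq_exp2l // (leq_trans sK).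
by apply: fan_of_rich_grid => //; apply: IH; exact: abundant_rich.
Qed.

End Grids.

(** * Elementary numerical bounds *)

Lemma ln2_le (R : realType) : ln (2 : R) <= 3 / 4.
Proof.
rewrite -ler_expR lnK ?posrE //.
(* [expR (3 / 4)] is the sixth power of [expR (1 / 8)], and [(9 / 8) ^ 6 > 2]. *)
have -> : (3 / 4 : R) = 6%:R * (1 / 8) by lra.
rewrite mulrC expRM_natr.
have e8 : 1 + 1 / 8 <= expR (1 / 8 : R) by exact: expR_ge1Dx.
apply: (@le_trans _ _ ((1 + 1 / 8 : R) ^+ 6)); first by lra.
by rewrite lerXn2r ?nnegrE ?expR_ge0 //; lra.
Qed.

(* 19/6 = 8/3 + 1/2: rounding 8/(3u) up costs at most 1 <= 1/(2u). *)
Lemma exists_branching (R : realType) (u : R) : 0 < u -> u <= 1 / 2 ->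
  exists K : nat, 8 <= 3 * (K%:R * u) /\ K%:R * u <= 19 / 6.
Proof.
move=> u_gt0 u_le; exists (Num.truncn (8 / (3 * u))).+1.
have p : 0 < 3 * u by rewrite mulr_gt0.
have : 8 / (3 * u) < (Num.truncn (8 / (3 * u))).+1%:R by exact: truncnS_gt.
have : (Num.truncn (8 / (3 * u)))%:R <= 8 / (3 * u).
  by rewrite truncn_le divr_ge0 // ltW.
rewrite ler_pdivlMr // ltr_pdivrMr // -natr1; nra.
Qed.

(** * Consequences of the choice of [K], where [r = k + 2] and [u = c ^ (r - 1)] *)

Section Branching.
Variables (R : realType) (c : R) (k s n K : nat).
Local Notation u := (c ^+ k.+1).
Hypotheses (c_gt0 : 0 < c) (c_le : c <= 1 / 2) (s_gt0 : (0 < s)%N).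
Hypotheses (Ku_ge : 8 <= 3 * (K%:R * u)) (Ku_le : K%:R * u <= 19 / 6).
Hypothesis s_le : s%:R <= c ^+ (k.+2 ^ 2) * ln (n%:R : R).

Let c_le1 : c <= 1. Proof. by move: c_le; lra. Qed.

Let c2_le : c ^+ 2 <= 1 / 4. Proof. by move: c_le c_gt0; nra. Qed.

Let u_gt0 : 0 < u. Proof. exact: exprn_gt0. Qed.

Let u_le : u <= 1 / 2.
Proof.
rewrite exprS; apply: le_trans c_le.
by rewrite ler_piMr ?(ltW c_gt0) // exprn_ile1 ?(ltW c_gt0).
Qed.

Let K_gt0 : (0 < K)%N.
Proof. by case: K Ku_ge => //; rewrite mul0r mulr0 lern0. Qed.

Let ln_n_gt0 : 0 < ln (n%:R : R).
Proof.
have : 0 < c ^+ (k.+2 ^ 2) * ln (n%:R : R).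
  by apply: lt_le_trans s_le; rewrite ltr0n.
by rewrite pmulr_rgt0 ?exprn_gt0.
Qed.

Let n_gt0 : 0 < n%:R :> R.
Proof.
by rewrite ltNge; apply/negP => /ln0 n0; move: ln_n_gt0; rewrite n0 ltxx.
Qed.

(** Since [2 * c <= 1], [K * c >= 8 / 3 * 2 ^ k >= 8 / 3 * (k + 1)], and
    [16 / 3 * (k + 1) >= 4 * (k + 1) + 1]. *)
Lemma branching_density : (4 * k.+1 + 1)%:R <= 2 * K%:R * c.
Proof.
have cK : 0 <= K%:R * c by rewrite mulr_ge0 ?ler0n ?(ltW c_gt0).
have : (2 * c) ^+ k <= 1.
  by rewrite exprn_ile1 ?mulr_ge0 ?(ltW c_gt0) //; move: c_le; lra.
move/(ler_wpM2l cK); rewrite mulr1 exprMn => le.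
have k2 : (k.+1)%:R <= 2 ^+ k :> R by rewrite -natrX ler_nat ltn_expl.
have ge : 8 <= 3 * (K%:R * c * c ^+ k) by rewrite -mulrA -exprS.
have {}ge : 8 * 2 ^+ k <= 3 * (K%:R * c * (2 ^+ k * c ^+ k)).
  have := ler_wpM2r (exprn_ge0 k (ler0n R 2)) ge; rewrite /=.
  by rewrite -!mulrA [c ^+ k * _]mulrC.
rewrite natrD natrM -mulrA.
have : 1 <= k.+1%:R :> R by rewrite ler1n.
by move: k2 le ge; set t := K%:R * c * _; move: t (K%:R * c) => t d; lra.
Qed.

Let m := (s * K ^ k.+1)%N.

(** Splitting the exponent [r ^ 2] turns [c ^ (r ^ 2) * K ^ (k + 1)] into
    [(K * u * c ^ 2) ^ (k + 1) * c], whose base is at most [19 / 6 * 1 / 4 = 19 / 24], while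
    [c <= 1 / 2]. *)
Let m_le : m%:R <= 19 / 48 * ln (n%:R : R).
Proof.
rewrite /m natrM natrX.
apply: (@le_trans _ _ (c ^+ (k.+2 ^ 2) * ln (n%:R : R) * K%:R ^+ k.+1)).
  by rewrite ler_wpM2r ?exprn_ge0.
rewrite mulrAC ler_wpM2r ?(ltW ln_n_gt0) //.
have -> : (k.+2 ^ 2 = k.+1 * k.+1 + 2 * k.+1 + 1)%N by lia.
rewrite !exprD !exprM expr1.
have -> : u ^+ k.+1 * (c ^+ 2) ^+ k.+1 * c * K%:R ^+ k.+1 =
  (K%:R * u * c ^+ 2) ^+ k.+1 * c by rewrite !exprMn; ring.
have c2 : 0 <= c ^+ 2 <= 1 / 4 by rewrite sqr_ge0.
have /andP[q0 q1] : 0 <= K%:R * u * c ^+ 2 <= 19 / 24.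
  have Ku0 : 0 <= K%:R * u by move: Ku_ge; lra.
  move: Ku_le Ku0 c2; move: (K%:R * u) (c ^+ 2) => a b h1 h2 /andP[h3 h4].
  by apply/andP; split; nra.
have qk : 0 <= (K%:R * u * c ^+ 2) ^+ k.+1 <= 19 / 24.
  rewrite exprn_ge0 //= exprS; apply: (le_trans _ q1).
  by rewrite ler_piMr // exprn_ile1 // (le_trans q1) //; lra.
by move: qk c_gt0 c_le; move: (_ ^+ k.+1) => q /andP[]; nra.
Qed.

Lemma branching_power_le : (K * (s * K ^ k.+1) * 2 ^ (s * K ^ k.+1).+1 <= n)%N.
Proof.
rewrite -/m; have Km : (K <= m)%N.
  by rewrite /m expnS mulnCA leq_pmulr // muln_gt0 s_gt0 expn_gt0 K_gt0.
have m_gt0 : (0 < m)%N by exact: leq_trans Km.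
(* The three factors [2 ^ m] of [8 ^ m] bound [K], [2 * m] and [2 ^ m]; then [8 ^ m <= n] because
   [3 * 19 / 48 * 3 / 4 < 1]. *)
apply: (@leq_trans (8 ^ m)).
  have m2 : (m < 2 ^ m)%N by exact: ltn_expl.
  have m21 : (2 * m <= 2 ^ m)%N.
    by rewrite -(prednK m_gt0) expnS leq_mul2l /= ltn_expl.
  rewrite (_ : 8 = 2 * 2 * 2)%N // !expnMn expnS mulnA leq_mul2r.
  by rewrite -mulnA (mulnC m) leq_mul ?orbT // (leq_trans Km) ?(ltnW m2).
rewrite -(ler_nat R) (_ : (8 ^ m)%:R = (2 : R) ^+ (3 * m)); last first.
  by rewrite -natrX expnM.
rewrite -ler_ln ?posrE ?exprn_gt0 // lnXn // -[_ *+ (3 * m)]mulr_natl natrM.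
have m0 : 0 <= m%:R :> R by [].
by move: (ln2_le R) m_le ln_n_gt0 m0; move: m%:R (ln 2) (ln n%:R) => a b d; nra.
Qed.

(** By [K ^ 2 <= 2 ^ K], the logarithm of the left side is at most [3 / 2 * s * K * ln 2], and
    [3 / 2 * 19 / 24 * 3 / 4 < 1]. *)
Lemma branching_loss_lt : (K * 2 ^ (s * K))%:R < (n%:R : R) `^ (c ^+ k.+1).
Proof.
rewrite /powR gt_eqF //.
have K4 : (5 < K)%N.
  by rewrite -(ltr_nat R); move: Ku_ge u_le u_gt0; nra.
have K2 : (K ^ 2 <= 2 ^ K)%N.
  elim: K K4 => // j IH; rewrite leq_eqVlt => /predU1P[<- //|j5].
  by have := IH j5; rewrite (expnS 2 j) -!mulnn; move: (2 ^ j)%N; nia.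
have sq : ((K * 2 ^ (s * K)) ^ 2 <= 2 ^ (3 * (s * K)))%N.
  rewrite expnMn -expnM (leq_trans (leq_mul K2 (leqnn _))) // -expnD.
  by rewrite leq_exp2l //; nia.
have p0 : 0 < (K * 2 ^ (s * K))%:R :> R.
  by rewrite ltr0n muln_gt0 K_gt0 expn_gt0.
rewrite -[X in X < _]lnK // ltr_expR.
have : 2%:R * ln ((K * 2 ^ (s * K))%:R : R) <= (3 * (s * K))%:R * ln 2.
  rewrite !mulr_natl -!lnXn // ler_ln ?posrE ?exprn_gt0 //.
  by rewrite -!natrX ler_nat.
suff : s%:R * K%:R <= 19 / 24 * (u * ln (n%:R : R)).
  rewrite natrM natrM; have := ln2_le R.
  have : 0 < u * ln (n%:R : R) by exact: mulr_gt0.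
  have : 0 <= s%:R * K%:R :> R by rewrite mulr_ge0.
  nra.
apply: (@le_trans _ _ (c ^+ (k.+2 ^ 2) * ln (n%:R : R) * K%:R)).
  by rewrite ler_wpM2r.
(* One factor [u] offsets [K], the second becomes the exponent of [n], and the remaining power of
   [c] is at most [1 / 4]. *)
have -> : (k.+2 ^ 2 = k.+1 + k.+1 + (k * (k + 2) + 2))%N by lia.
rewrite (exprD c (k.+1 + k.+1)) (exprD c k.+1).
have ck : c ^+ (k * (k + 2) + 2) <= 1 / 4.
  rewrite exprD; have : c ^+ (k * (k + 2)) <= 1.
    by rewrite exprn_ile1 ?(ltW c_gt0).
  have : 0 <= c ^+ (k * (k + 2)) by rewrite exprn_ge0 // ltW.
  have c2 : 0 <= c ^+ 2 <= 1 / 4 by rewrite sqr_ge0.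
  by move: c2; move: (c ^+ 2) (c ^+ (k * _)) => a b /andP[]; nra.
have ck0 : 0 <= c ^+ (k * (k + 2) + 2) by rewrite exprn_ge0 // ltW.
set d := c ^+ (_ + 2) in ck ck0 *.
have -> : u * u * d * ln n%:R * K%:R = (K%:R * u * d) * (u * ln n%:R) by ring.
rewrite ler_wpM2r ?mulr_ge0 ?(ltW u_gt0) ?(ltW ln_n_gt0) //.
by move: Ku_le Ku_ge; move: (K%:R * u) => y; nra.
Qed.

End Branching.

(** * Ordered embeddings of [H] in [G] *)

Section Embeddings.
Local Open Scope nat_scope.
Variables (k : nat) (H : rel 'I_k.+1) (V : finType) (G : rel V).

(* [u != v] is part of the relation so that the classes come out disjoint. *)
Definition agree (i j : nat) : rel V :=
  fun u v => (u != v) && (G u v == H (inord i) (inord j)).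

Definition embeddings :=
  [set x : k.+1.-tuple V | [forall i, forall j,
    (i != j) ==> agree (val i) (val j) (tnth x i) (tnth x j)]].

(** Copies are counted as vertex sets, and each is the set of entries of at least one embedding. *)
Lemma num_induced_copies_le : num_induced_copies H G <= #|embeddings|.
Proof.
pose im (x : k.+1.-tuple V) := [set tnth x i | i in 'I_k.+1].
apply: leq_trans (leq_imset_card im embeddings).
apply/subset_leq_card/subsetP => S; rewrite inE.
case/existsP=> f /and3P[/injectiveP f_inj /eqP fS /forallP fG].
apply/imsetP; exists [tuple f i | i < k.+1].
  rewrite inE; apply/forallP => i; apply/forallP => j; apply/implyP => ij.
  rewrite !tnth_mktuple /agree (inj_eq f_inj) ij !inord_val.
  by have /forallP := fG i; apply.
by rewrite -fS; apply: eq_imset => i; rewrite tnth_mktuple.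
Qed.

Lemma compatible_embeddings v0 : compatible v0 agree embeddings.
Proof.
move=> x i j; rewrite inE => /forallP xP ij ik jk.
have /forallP/(_ (Ordinal jk)) := xP (Ordinal ik).
by rewrite !(tnth_nth v0) => /implyP; apply.
Qed.

Lemma num_induced_copies_gt0 : 0 < num_induced_copies H G -> k < #|V|.
Proof.
case/card_gt0P => S; rewrite inE => /existsP[f /and3P[/injectiveP f_inj _ _]].
by have := leq_card f f_inj; rewrite card_ord.
Qed.

End Embeddings.

Lemma agree_sym (k : nat) (H : rel 'I_k.+1) (V : finType) (G : rel V) :
  symmetric H -> symmetric G ->
  forall i j u v, agree H G i j u v -> agree H G j i v u.
Proof. by move=> Hs Gs i j u v; rewrite /agree eq_sym Gs Hs. Qed.

(** Two small classes agree with [H] by consistency of the grid, a small class and [T] by the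
    embeddings ending in [T]. Transversality gives the sizes. *)
Lemma induced_type_of_fan (k : nat) (H : rel 'I_k.+1) (V : finType)
    (G : rel V) (v0 : V) (S : {set k.-tuple V}) (T : {set V}) :
  symmetric H -> symmetric G -> (0 < #|S|)%N ->
  grid v0 (agree H G) S ->
  (forall x v, x \in S -> v \in T -> [tuple of rcons x v] \in embeddings H G) ->
  has_induced_type_sst H G #|S| #|T|.
Proof.
move=> Hs Gs /card_gt0P[x0 x0S] [cS tS] ST.
pose P (i : 'I_k.+1) :=
  if (i < k)%N then [set nth v0 (tval x) i | x in S] else T.
have agreeP (i j : 'I_k.+1) x y :
    i != j -> x \in P i -> y \in P j -> agree H G i j x y.
  wlog lt_ij : i j x y / (i < j)%N.
    move=> wl ij xi yj; have /orP[lt|lt] : (i < j)%N || (j < i)%N.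
    - by rewrite -neq_ltn.
    - exact: wl.
    - by apply: agree_sym => //; apply: wl; rewrite // eq_sym.
  move=> ij; have ik : (i < k)%N by apply: leq_trans lt_ij _; rewrite -ltnS.
  rewrite /P ik => /imsetP[a aS ->]; case: ifPn => [jk /imsetP[b bS ->]|jk yT].
    exact: cS.
  have jE : val j = k by apply/eqP; rewrite eqn_leq -ltnS ltn_ord leqNgt.
  have := compatible_embeddings v0 (ST a y aS yT) ij (ltn_ord i) (ltn_ord j).
  by rewrite /= !nth_rcons size_tuple ik jE ltnn eqxx.
exists P; split.
- move=> i j ij; apply/pred0P => x /=; apply/negbTE/negP => /andP[xi xj].
  by have /andP[/eqP] := agreeP _ _ _ _ ij xi xj.
- move=> i /= ik; rewrite /P ik card_in_imset // => x y xS yS; exact: tS.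
- by move=> i /= iE; rewrite /P iE ltnn.
- move=> i j x y ij xi yj; have /andP[_ /eqP] := agreeP _ _ _ _ ij xi yj.
  by rewrite !inord_val.
Qed.

(** * The lower bound on [t] and the assembly *)

Lemma powR_onem_lt (R : realType) (u a q t : R) :
  0 < a -> 0 < t -> a <= q * t -> q < a `^ u -> a `^ (1 - u) < t.
Proof.
move=> a0 t0 aqt qau.
have au0 : 0 < a `^ u by exact: powR_gt0.
have split1 : a `^ (1 - u) * a `^ u = a.
  by rewrite -powRD ?(gt_eqF a0) ?implybT // subrK powRr1 ?ltW.
rewrite -(ltr_pM2r au0) split1.
by apply: le_lt_trans aqt _; rewrite mulrC ltr_pM2l.
Qed.

Theorem theorem2 (R : realType) (r : nat) (c : R) (H : rel 'I_r)
    (V : finType) (G : rel V) :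
  (2 <= r)%N -> 0 < c -> c <= 1 / 2 ->
  is_graph H -> is_graph G ->
  c * (#|V|%:R) ^+ r < (num_induced_copies H G)%:R ->
  exists t : nat,
    (#|V|%:R) `^ (1 - c ^+ r.-1) < t%:R /\
    has_induced_type_sst H G
      `|Num.floor (c ^+ (r ^ 2) * ln (#|V|%:R : R))|%N t.
Proof.
case: r H => [|[|k]] // H _ c0 c_le [_ Hs] [_ Gs] dense.
set n := #|V| in dense *; set N := num_induced_copies H G in dense *.
have N0 : (0 < N)%N.
  rewrite -(ltr_nat R); apply: le_lt_trans dense.
  by rewrite mulr_ge0 ?exprn_ge0 ?(ltW c0).
have n_gt1 : (1 < n)%N by apply: leq_trans (num_induced_copies_gt0 N0).
have n0 : 0 < n%:R :> R by rewrite ltr0n ltnW.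
have lnn : 0 < ln (n%:R : R) by rewrite ln_gt0 // ltr1n.
rewrite -[k.+2.-1]/k.+1; set s := `|_|%N.
have s_le : s%:R <= c ^+ (k.+2 ^ 2) * ln (n%:R : R).
  have y0 : 0 <= c ^+ (k.+2 ^ 2) * ln (n%:R : R).
    by rewrite mulr_ge0 ?exprn_ge0 ?ltW.
  by rewrite /s natr_absz ger0_norm ?floor_ge0 // floor_le.
have u0 : 0 < c ^+ k.+1 by exact: exprn_gt0.
(* For [s = 0] the last class is all of [V] and the others are empty; [t = n] is large enough since
   [n ^ u > 1]. *)
have [s0|s_gt0] := posnP s.
  exists n; split.
    apply: (@powR_onem_lt _ _ _ 1); rewrite ?mul1r //.
    by rewrite /powR gt_eqF // expR_gt1 mulr_gt0.
  exists (fun i => if val i == k.+1 then [set: V] else set0); split.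
  - move=> i j ij; case: ifP => [/eqP iE|_]; last by rewrite -setI_eq0 set0I.
    case: ifP => [/eqP jE|_]; last by rewrite -setI_eq0 setI0.
    by rewrite -val_eqE /= iE jE eqxx in ij.
  - by move=> i /= ik; rewrite ltn_eqF // cards0.
  - by move=> i /= ->; rewrite eqxx cardsT.
  - move=> i j x y ij; case: ifP => [/eqP iE|_]; last by rewrite !inE.
    case: ifP => [/eqP jE|_]; last by rewrite !inE.
    by rewrite -val_eqE /= iE jE eqxx in ij.
have u_le : c ^+ k.+1 <= 1 / 2.
  apply: (le_trans _ c_le).
  rewrite exprS ler_piMr ?(ltW c0) // exprn_ile1 ?(ltW c0) //.
  by move: c_le; lra.
have [K [Ku_ge Ku_le]] := exists_branching u0 u_le.
have K0 : (0 < K)%N.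
  by case: K Ku_ge {Ku_le} => //; rewrite mul0r mulr0 lern0.
have [v0 _] : exists v0 : V, v0 \in V by apply/card_gt0P; exact: ltnW.
have Rs := agree_sym Hs Gs.
have abM : abundant v0 (agree H G) K s (embeddings H G).
  split=> //; first exact: compatible_embeddings.
    rewrite -(ler_nat R) natrM natrX (natrM _ (2 * K)) (natrM _ 2).
    apply: (@le_trans _ _ (2 * K%:R * c * n%:R ^+ k.+2)).
      rewrite ler_wpM2r ?exprn_ge0 //; exact: (@branching_density _ _ k).
    rewrite -mulrA ler_wpM2l ?mulr_ge0 // (le_trans (ltW dense)) // ler_nat.
    exact: num_induced_copies_le.
  exact: (@branching_power_le R c).
(* The grid is sought one level down, among the rich tuples of length [r - 1]; stopping the last
   ascent at the fan avoids cutting [T] down to [s] elements. *)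
have [S [T [gS cS ST VT]]] : has_fan v0 (agree H G) K s (embeddings H G).
  apply: fan_of_rich_grid => //; apply: (abundant_grid K0 Rs).
  exact: abundant_rich.
exists #|T|; split.
  apply: (@powR_onem_lt _ _ _ (K * 2 ^ (s * K))%:R) => //.
  - rewrite ltr0n lt0n; apply: contraTneq VT => ->.
    by rewrite muln0 -ltnNge ltnW.
  - by rewrite -natrM ler_nat.
  - exact: branching_loss_lt.
by rewrite -cS; apply: induced_type_of_fan gS ST; rewrite ?cS.
Qed.
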